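(* Let $\Omega=(0,1)$, $a\in L^\infty(\Omega)$ with $0<\alpha\le a(x)\le\beta$, and let $u\in H^1(\Omega)$ be the solution of the variational problem $B(u,v)=F(v)$ for the model problem $-(au')'=f$ on $\Omega$, where it is a priori known that $u(0)=0$. Let the uniform mesh, hat functions $N_i$, patches $\omega_i$, patch interpolants $I_{\omega_i}$, spaces $\overline{V}_i$ and sets $\mathcal{T}_1,\mathcal{T}_2$ be as in the context. Suppose that for each $x_i\in\mathcal{T}_2$ there exist $\bar{\xi}^i\in\overline{V}_i$, $\epsilon_i\ge 0$, and a constant $C_1>0$ independent of $i$, such that \[ \|u-I_{\omega_i}u-\bar{\xi}^i\|_{L^2(\omega_i)}\le C_1\,\mathrm{diam}(\omega_i)\,\|u-I_{\omega_i}u-\bar{\xi}^i\|_{\mathcal{E}(\omega_i)} \quad\text{and}\quad \|u-I_{\omega_i}u-\bar{\xi}^i\|_{\mathcal{E}(\omega_i)}\le\epsilon_i . \] Then there exists $v\in\mathcal{S}=\mathcal{S}_1+\overline{\mathcal{S}}_2$ such that \[ \|u-v\|_{\mathcal{E}(\Omega)}\le C\Big\{\sum_{x_i\in\mathcal{T}\setminus\mathcal{T}_2}\|u-I_{\omega_i}u\|^2_{\mathcal{E}(\omega_i)}+\sum_{x_i\in\mathcal{T}_2}\epsilon_i^2\Big\}^{1/2}, \] where $C$ is a constant independent of $h$ and of the $\epsilon_i$.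
   Context: Energy norm: for an open set $\omega\subset\Omega$, $\|v\|_{\mathcal{E}(\omega)}=\big(\int_\omega a|v'|^2\,dx\big)^{1/2}$; $B(u,v)=\int_\Omega a u'v'\,dx$. Mesh: $h=1/N$, vertices $x_k=kh$, $k=0,\dots,N$, set of vertices $\mathcal{T}=\{x_0,\dots,x_N\}$, elements $\tau_k=[x_{k-1},x_k]$, $k=1,\dots,N$. $N_i$ is the continuous piecewise linear hat function with $N_i(x_j)=\delta_{ij}$ (so $\{N_i\}$ is a partition of unity); the patch is $\omega_i=(x_{i-1},x_{i+1})$ for $1\le i\le N-1$, $\omega_0=(x_0,x_1)$, $\omega_N=(x_{N-1},x_N)$; the vertices of $\omega_i$ are $x_{i-1},x_i,x_{i+1}$ (resp. $x_0,x_1$ and $x_{N-1},x_N$). For $w\in H^1(\omega_i)$, $I_{\omega_i}w=\sum_k w(x_k)N_k|_{\omega_i}$, the sum over the vertices $x_k$ of $\omega_i$ (piecewise linear interpolant on the patch). For each $x_i\in\mathcal{T}$ a local space $V_i=\mathrm{span}\{\phi^i_j\}_{j=0}^{n_i}\subset H^1(\omega_i)$ is given, and $\overline{V}_i=\mathrm{span}\{\bar\phi^i_j\}_{j=1}^{n_i}$ with $\bar\phi^i_j=\phi^i_j-I_{\omega_i}\phi^i_j$. $\mathcal{T}_1=\{x_i:1\le i\le N\}$, $\mathcal{T}_2=\{x_i\in\mathcal{T}:\overline{V}_i\neq\{0\}\}$. $\mathcal{S}_1=\{\sum_{x_i\in\mathcal{T}_1}a_iN_i: a_i\in\mathbb{R}\}$,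 $\overline{\mathcal{S}}_2=\{\sum_{x_i\in\mathcal{T}_2}N_i\bar\xi^i:\bar\xi^i\in\overline{V}_i\}$ (each $N_i\bar\xi^i$ extended by zero outside $\omega_i$). *)

(* Defs.v *)
From HB Require Import structures.
From mathcomp Require Import all_boot all_order all_algebra.
From mathcomp Require Import all_classical all_reals all_analysis.
Set Implicit Arguments. Unset Strict Implicit. Unset Printing Implicit Defensive.
Import Order.TTheory GRing.Theory Num.Theory.
Import numFieldNormedType.Exports.
Local Open Scope classical_set_scope.
Local Open Scope ring_scope.

Section Defs.
Context {R : realType}.
Local Notation mu := (@lebesgue_measure R).

(* du is the (a.e.-unique, L^2) derivative of u on [c,d]:
   u is absolutely continuous on [c,d] with u(x) = u(c) + int_c^x du. *)
Definition is_deriv (c d : R) (u du : R -> R) : Prop :=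
  [/\ measurable_fun `[c, d] du,
      (\int[mu]_(x in `[c, d]) ((du x) ^+ 2)%:E < +oo)%E &
      forall x, c <= x <= d -> u x = u c + Rintegral mu `[c, x] du].

(* H^1(c,d), identified with its continuous representatives. *)
Definition H1 (c d : R) (u : R -> R) : Prop := exists du, is_deriv c d u du.

(* a chosen weak derivative (0 if none exists) *)
Definition dchoose (c d : R) (u : R -> R) : R -> R :=
  xget (fun _ => 0) [set du | is_deriv c d u du].

Definition Enorm (a : R -> R) (c d : R) (w : R -> R) : R :=
  Num.sqrt (fine (\int[mu]_(x in `]c, d[) (a x * (dchoose c d w x) ^+ 2)%:E)).

Definition L2norm (c d : R) (w : R -> R) : R :=
  Num.sqrt (fine (\int[mu]_(x in `]c, d[) ((w x) ^+ 2)%:E)).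

Definition node (N k : nat) : R := k%:R / N%:R.

Definition hat (N k : nat) (x : R) : R :=
  Num.max 0 (1 - `|x - node N k| * N%:R).

(* patch omega_i = (x_{i-1}, x_{i+1}), resp. (x_0,x_1), (x_{N-1},x_N) *)
Definition plo (N i : nat) : R := node N i.-1.
Definition phi_ (N i : nat) : R := node N (minn i.+1 N).
Definition diam (N i : nat) : R := phi_ N i - plo N i.

Definition Ipatch (N i : nat) (w : R -> R) : R -> R :=
  fun x => \sum_(i.-1 <= k < (minn i.+1 N).+1) w (node N k) * hat N k x.

Definition inVbar (N : nat) (n : nat -> nat) (phi : nat -> nat -> R -> R)
    (i : nat) (xi : R -> R) : Prop :=
  exists c : nat -> R, forall x, plo N i <= x <= phi_ N i ->
    xi x = \sum_(1 <= j < (n i).+1)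
              c j * (phi i j x - Ipatch N i (phi i j) x).

Definition inT2 (N : nat) (n : nat -> nat) (phi : nat -> nat -> R -> R)
    (i : nat) : Prop :=
  exists xi, inVbar N n phi i xi /\
    exists x, plo N i < x < phi_ N i /\ xi x <> 0.

Definition inS (N : nat) (n : nat -> nat) (phi : nat -> nat -> R -> R)
    (v : R -> R) : Prop :=
  exists (coef : nat -> R) (xi : nat -> R -> R),
    (forall i, (i <= N)%N -> inT2 N n phi i -> inVbar N n phi i (xi i)) /\
    forall x, 0 <= x <= 1 ->
      v x = \sum_(1 <= i < N.+1) coef i * hat N i x
          + \sum_(0 <= i < N.+1 | `[< inT2 N n phi i >])
               (if plo N i < x < phi_ N i then hat N i x * xi i x else 0).

End Defs.

(* Main.v *)
Require Import Defs.
From HB Require Import structures.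
From mathcomp Require Import all_boot all_order all_algebra.
From mathcomp Require Import all_classical all_reals all_analysis.
From mathcomp Require Import measurable_realfun ring lra.
Import Order.TTheory GRing.Theory Num.Theory.
Import numFieldNormedType.Exports.
Local Open Scope classical_set_scope.
Local Open Scope ring_scope.
Set Implicit Arguments.
Unset Strict Implicit.
Unset Printing Implicit Defensive.

(** On the element [x_k, x_(k+1)] all patch interpolants agree with the nodal
interpolant and the two hat functions add up to 1, so for
v = sum_i u(x_i) N_i + sum_(T_2) N_i xi_i the error is
N_k w_k + N_(k+1) w_(k+1), where w_i = u - I_i u - xi_i (with xi_i = 0 off T_2).
Each w_i vanishes at the vertices of its patch, so the Poincare inequality on
the element, w_i^2 <= h int |w_i'|^2, absorbs the factor 1/h of N_i' and bounds
the element energy of the error by that of w_k and w_(k+1).  Summing over the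
elements counts every patch at most twice, and comparing a with alpha and beta
gives the constant (16 beta / alpha)^(1/2). *)

(** * One-dimensional H1 calculus *)

Section calculus.
Context {R : realType}.
Local Notation mu := (@lebesgue_measure R).
Local Notation intg c d f := (mu.-integrable `[c, d] (EFin \o f)).
Implicit Types (c d m x y p q : R) (f g u w du dw : R -> R).

(** Measurability is a separate clause because integrability of the square does not give it. *)
Definition sqint c d g : Prop :=
  measurable_fun `[c, d] g /\ intg c d (fun x => g x ^+ 2).

(** The argument is the derivative itself, so estimates can be made for an explicit derivative and
    without the coefficient [a], which enters only in [Enorm_bounds]. *)
Definition dirichlet c d g : R := Rintegral mu `[c, d] (fun x => g x ^+ 2).

Lemma sub_itvcc c d x y : c <= x -> y <= d -> `[x, y] `<=` `[c, d].
Proof.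
move=> cx yd z /=; rewrite !in_itv/= => /andP[xz zy].
by rewrite (le_trans cx)//= (le_trans zy).
Qed.

Lemma intgS c d x y f : c <= x -> y <= d -> intg c d f -> intg x y f.
Proof.
by move=> cx yd; apply: integrableS => //; exact: sub_itvcc.
Qed.

Lemma intg_dominated c d f g : measurable_fun `[c, d] f ->
  (forall x, c <= x <= d -> `|f x| <= g x) -> intg c d g -> intg c d f.
Proof.
move=> mf fg; apply: le_integrable => //; first exact/measurable_EFinP.
move=> x /=; rewrite in_itv/= => xcd.
by rewrite lee_fin (le_trans (fg _ xcd))// ler_norm.
Qed.

Lemma intg_cst c d r : intg c d (fun=> r).
Proof.
apply: measurable_bounded_integrable => //; last first.
  by exists `|r|; split=> // M rM x _ /=; exact: ltW.
exact: compact_finite_measure (@segment_compact _ c d).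
Qed.

Lemma intgD c d f g : intg c d f -> intg c d g -> intg c d (fun x => f x + g x).
Proof. by move=> fi gi; exact: integrableD fi gi. Qed.

Lemma intgZ c d r f : intg c d f -> intg c d (fun x => r * f x).
Proof. by move=> fi; exact: integrableZl fi. Qed.

Lemma Rintegral_cst_itvcc c d r : c <= d ->
  Rintegral mu `[c, d] (fun=> r) = r * (d - c).
Proof.
move=> cd; rewrite Rintegral_cst// [X in fine X](lebesgue_measure_itv `[c, d])/= lte_fin.
by case: ltP => //= dc; congr (_ * _); apply/esym/eqP; rewrite subr_eq0 eq_le dc.
Qed.

Lemma Rintegral_chasles c d m f : c <= m -> m <= d -> intg c d f ->
  Rintegral mu `[c, d] f = Rintegral mu `[c, m] f + Rintegral mu `[m, d] f.
Proof.
move=> cm md fi; rewrite -(@Rintegral_itv_obnd_cbnd _ m).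
  rewrite -(@Rintegral_itvB _ f (BLeft c) (BRight d) m) ?bnd_simp//.
  by rewrite addrC subrK.
apply: integrableS fi => // z /=; rewrite !in_itv/= => /andP[mz ->].
by rewrite (le_trans cm)// ltW.
Qed.

Lemma sqintS c d x y g : c <= x -> y <= d -> sqint c d g -> sqint x y g.
Proof.
move=> cx yd [mg ig]; split; last exact: intgS ig.
by apply: measurable_funS mg => //; exact: sub_itvcc.
Qed.

(** Constants are integrable on a bounded interval, and |g| <= 1 + g^2. *)
Lemma sqint_intg c d g : sqint c d g -> intg c d g.
Proof.
move=> [mg ig].
apply: (intg_dominated (g := fun x => 1 + g x ^+ 2)) => //.
  move=> x _; have := sqr_ge0 (`|g x| - 1); rewrite sqrrB expr1n -normrX.
  rewrite (ger0_norm (sqr_ge0 _)); have := normr_ge0 (g x).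
  by move: (`|g x|) (g x ^+ 2) => a b; lra.
exact: intgD (intg_cst c d 1) ig.
Qed.

Lemma sqint_dominated c d f g : measurable_fun `[c, d] f ->
  (forall x, c <= x <= d -> f x ^+ 2 <= g x) -> intg c d g -> sqint c d f.
Proof.
move=> mf fg ig; split => //; apply: intg_dominated ig => //.
  exact: measurable_funX.
by move=> x /fg; rewrite ger0_norm ?sqr_ge0.
Qed.

Lemma sqintD c d f g : sqint c d f -> sqint c d g ->
  sqint c d (fun x => f x + g x).
Proof.
move=> [mf iF] [mg iG].
apply: (sqint_dominated (g := fun x => 2 * f x ^+ 2 + 2 * g x ^+ 2)).
- exact: measurable_funD.
- by move=> x _; have := sqr_ge0 (f x - g x); rewrite sqrrB sqrrD !mulr2n; lra.
- by apply: intgD; exact: intgZ.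
Qed.

Lemma sqintZ c d r g : sqint c d g -> sqint c d (fun x => r * g x).
Proof.
move=> [mg iG]; apply: (sqint_dominated (g := fun x => r ^+ 2 * g x ^+ 2)).
- exact: measurable_funM.
- by move=> x _; rewrite exprMn.
- exact: intgZ.
Qed.

Lemma sqint_cst c d r : sqint c d (fun=> r).
Proof. by split=> //; exact: intg_cst. Qed.

Lemma eq_sqint c d f g : (forall x, c <= x <= d -> f x = g x) ->
  sqint c d f -> sqint c d g.
Proof.
move=> fg [mf iF]; split.
  by apply: eq_measurable_fun mf => x; rewrite inE/= in_itv/= => /fg.
by apply: eq_integrable iF => // x; rewrite inE/= in_itv/= => /fg ->.
Qed.

Lemma dirichlet_ge0 c d g : 0 <= dirichlet c d g.
Proof. by apply: Rintegral_ge0 => x _; exact: sqr_ge0. Qed.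

Lemma dirichlet_chasles c d m g : c <= m -> m <= d -> sqint c d g ->
  dirichlet c d g = dirichlet c m g + dirichlet m d g.
Proof. by move=> cm md [_ ig]; exact: Rintegral_chasles. Qed.

Lemma le_dirichletS c d x y g : c <= x -> x <= y -> y <= d -> sqint c d g ->
  dirichlet x y g <= dirichlet c d g.
Proof.
move=> cx xy yd sg.
rewrite (dirichlet_chasles cx (le_trans xy yd) sg).
rewrite (dirichlet_chasles xy yd (sqintS cx (lexx d) sg)).
have := dirichlet_ge0 c x g; have := dirichlet_ge0 y d g; lra.
Qed.

Lemma eq_dirichlet c d f g : (forall x, c <= x <= d -> f x = g x) ->
  dirichlet c d f = dirichlet c d g.
Proof.
by move=> fg; apply: eq_Rintegral => x; rewrite inE/= in_itv/= => /fg ->.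
Qed.

Lemma dirichletD_le c d f g : sqint c d f -> sqint c d g ->
  dirichlet c d (fun x => f x + g x) <= 2 * dirichlet c d f + 2 * dirichlet c d g.
Proof.
move=> sf sg; have [_ ifg] := sqintD sf sg.
case: sf sg => mf iF [mg iG].
have i2f : intg c d (fun x => 2 * f x ^+ 2) by exact: intgZ.
have i2g : intg c d (fun x => 2 * g x ^+ 2) by exact: intgZ.
rewrite /dirichlet -!RintegralZl// -RintegralD//.
apply: le_Rintegral => //; first exact: intgD.
by move=> x _; have := sqr_ge0 (f x - g x); rewrite sqrrB sqrrD !mulr2n; lra.
Qed.

(** * Weak derivatives, linear combinations and restriction *)

Lemma is_deriv_sqint c d u du : is_deriv c d u du -> sqint c d du.
Proof.
move=> [mdu iu _]; split=> //; apply/integrableP; split.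
  by apply/measurable_EFinP; exact: measurable_funX.
under eq_integral => x _ do rewrite /= ger0_norm ?sqr_ge0//.
by [].
Qed.

Lemma sqint_is_deriv c d u du : sqint c d du ->
  (forall x, c <= x <= d -> u x = u c + Rintegral mu `[c, x] du) ->
  is_deriv c d u du.
Proof.
by move=> [mdu iu] H; split => //; exact: integrable_lty iu.
Qed.

Lemma is_derivE c d u du x y : is_deriv c d u du -> c <= x -> x <= y -> y <= d ->
  u y = u x + Rintegral mu `[x, y] du.
Proof.
move=> H cx xy yd; have /sqint_intg idu := is_deriv_sqint H.
case: H => _ _ H.
rewrite (H y) ?(le_trans cx xy)// (H x) ?cx ?(le_trans xy yd)//.
by rewrite -addrA -Rintegral_chasles//; exact: intgS idu.
Qed.

Lemma is_derivS c d x y u du : c <= x -> y <= d ->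
  is_deriv c d u du -> is_deriv x y u du.
Proof.
move=> cx yd H; apply: sqint_is_deriv.
  exact: sqintS (is_deriv_sqint H).
move=> z /andP[xz zy]; apply: (is_derivE H) => //; exact: le_trans yd.
Qed.

Lemma eq_is_deriv c d u w du : c <= d -> (forall x, c <= x <= d -> u x = w x) ->
  is_deriv c d u du -> is_deriv c d w du.
Proof.
move=> cd uw [? ? H]; split => // x xcd; rewrite -!uw ?lexx//; exact: H.
Qed.

Lemma is_derivD c d u w du dw : is_deriv c d u du -> is_deriv c d w dw ->
  is_deriv c d (fun x => u x + w x) (fun x => du x + dw x).
Proof.
move=> Hu Hw; have su := is_deriv_sqint Hu; have sw := is_deriv_sqint Hw.
apply: sqint_is_deriv; first exact: sqintD.
move=> x /andP[cx xd]; rewrite RintegralD//; last 2 first.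
- by apply: intgS (sqint_intg su).
- by apply: intgS (sqint_intg sw).
rewrite (is_derivE Hu (lexx c) cx xd) (is_derivE Hw (lexx c) cx xd); ring.
Qed.

Lemma is_derivZ c d r u du : is_deriv c d u du ->
  is_deriv c d (fun x => r * u x) (fun x => r * du x).
Proof.
move=> Hu; have su := is_deriv_sqint Hu.
apply: sqint_is_deriv; first exact: sqintZ.
move=> x /andP[cx xd]; rewrite RintegralZl//; last first.
  by apply: intgS (sqint_intg su).
rewrite (is_derivE Hu (lexx c) cx xd); ring.
Qed.

Lemma is_deriv_affine c d p q :
  is_deriv c d (fun x => p + q * x) (fun=> q).
Proof.
apply: sqint_is_deriv; first exact: sqint_cst.
move=> x /andP[cx xd]; rewrite Rintegral_cst_itvcc//; ring.
Qed.

Lemma H1D c d u w : H1 c d u -> H1 c d w -> H1 c d (fun x => u x + w x).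
Proof. by move=> [du Hu] [dw Hw]; eexists; exact: is_derivD Hu Hw. Qed.

Lemma H1Z c d r u : H1 c d u -> H1 c d (fun x => r * u x).
Proof. by move=> [du Hu]; eexists; exact: is_derivZ Hu. Qed.

Lemma H1B c d u w : H1 c d u -> H1 c d w -> H1 c d (fun x => u x - w x).
Proof.
move=> Hu Hw; have := H1D Hu (H1Z (-1) Hw).
by under eq_fun do rewrite mulN1r.
Qed.

Lemma H1_sum c d (I : Type) (s : seq I) (P : pred I) (F : I -> R -> R) :
  (forall i, P i -> H1 c d (F i)) ->
  H1 c d (fun x => \sum_(i <- s | P i) F i x).
Proof.
move=> HF; elim: s => [|i s IH].
  rewrite (_ : (fun x => _) = fun=> 0); last by apply/funext => x; rewrite big_nil.
  exists (fun=> 0); have := is_deriv_affine c d 0 0.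
  by under eq_fun do rewrite mul0r addr0.
case: (boolP (P i)) => Pi; last first.
  rewrite (_ : (fun x => _) = fun x => \sum_(j <- s | P j) F j x)//.
  by apply/funext => x; rewrite big_cons (negbTE Pi).
rewrite (_ : (fun x => _) = fun x => F i x + \sum_(j <- s | P j) F j x); last first.
  by apply/funext => x; rewrite big_cons Pi.
by apply: H1D => //; exact: HF.
Qed.

Lemma H1S c d x y u : c <= x -> y <= d -> H1 c d u -> H1 x y u.
Proof. by move=> cx yd [du Hu]; exists du; exact: is_derivS Hu. Qed.

Lemma eq_H1 c d u w : c <= d -> (forall x, c <= x <= d -> u x = w x) ->
  H1 c d u -> H1 c d w.
Proof. by move=> cd uw [du Hu]; exists du; exact: eq_is_deriv Hu. Qed.

(* With n equal pieces the bounds telescope to (d - c) (V d - V c) / n. *)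
Lemma eq_of_subquadratic_increments c d (D V : R -> R) : c <= d ->
  (forall x y, c <= x -> x <= y -> y <= d ->
     `|D y - D x| <= (y - x) * (V y - V x)) ->
  D d = D c.
Proof.
move=> cd H; pose K := (d - c) * (V d - V c).
have step n : `|D d - D c| * n.+1%:R <= K.
  pose e := (d - c) / n.+1%:R; pose t k := c + k%:R * e.
  have e0 : 0 <= e by rewrite divr_ge0// subr_ge0.
  have tn : t n.+1 = d by rewrite /t mulrC divfK ?pnatr_eq0// addrC subrK.
  have tc k : c <= t k by rewrite lerDl mulr_ge0.
  have td k : (k <= n.+1)%N -> t k <= d.
    by move=> kn; rewrite -tn lerD2l ler_wpM2r// ler_nat.
  have tS k : t k.+1 - t k = e by rewrite /t -natr1; ring.
  have {}H k : (k <= n.+1)%N -> `|D (t k) - D c| <= e * (V (t k) - V c).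
    elim: k => [_|k IH kn]; first by rewrite /t mul0r addr0 !subrr normr0 mulr0.
    have -> : D (t k.+1) - D c = (D (t k.+1) - D (t k)) + (D (t k) - D c) by ring.
    have -> : V (t k.+1) - V c = (V (t k.+1) - V (t k)) + (V (t k) - V c) by ring.
    rewrite mulrDr (le_trans (ler_normD _ _))// lerD ?IH ?(ltnW kn)//.
    by rewrite -(tS k) H ?td// -subr_ge0 tS.
  have := H n.+1 (leqnn _); rewrite tn /e mulrAC.
  by rewrite ler_pdivlMr ?ltr0n.
(* By Archimedes, a nonzero increment would violate [step] for a number of pieces above K / |D d - D
   c|; [K0] rules out the value 0, for which [step] says nothing. *)
apply/eqP; rewrite -subr_eq0 -normr_le0 leNgt; apply/negP => D0.
have K0 : 0 <= K / `|D d - D c|.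
  by rewrite divr_ge0// (le_trans _ (step 0))// mulr_ge0.
have := archi_boundP K0; case: (Num.bound _) => [|n].
  by rewrite ltNge K0.
by rewrite ltr_pdivrMr// mulrC ltNge step.
Qed.

(** Cauchy-Schwarz against the constant 1: integrate (s - g)^2 >= 0, where s is the mean of g. The
    one-point interval is treated apart because s divides by the length. *)
Lemma sqr_Rintegral_le c d g : c <= d -> sqint c d g ->
  Rintegral mu `[c, d] g ^+ 2 <= (d - c) * dirichlet c d g.
Proof.
rewrite le_eqVlt => /predU1P[<- _|cd sg].
  by rewrite set_itv1 Rintegral_set1 subrr mul0r expr0n.
have h0 : 0 < d - c by rewrite subr_gt0.
have ig := sqint_intg sg; have [_ ig2] := sg.
set I := Rintegral _ _ _; pose s := I / (d - c).
have : 0 <= Rintegral mu `[c, d] (fun x => (s ^+ 2 + (- (2 * s)) * g x) + g x ^+ 2).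
  apply: Rintegral_ge0 => x _.
  by have := sqr_ge0 (s - g x); rewrite sqrrB mulr2n; lra.
have i1 : intg c d (fun=> s ^+ 2) by exact: intg_cst.
have i2 : intg c d (fun x => (- (2 * s)) * g x) by exact: intgZ.
rewrite RintegralD//; last exact: intgD.
rewrite RintegralD// Rintegral_cst_itvcc ?(ltW cd)// RintegralZl// -/I.
rewrite -/(dirichlet c d g) => H.
have Is : I = s * (d - c) by rewrite divfK// gt_eqF.
move: H; rewrite Is => H.
have -> : (s * (d - c)) ^+ 2 = (d - c) * (s ^+ 2 * (d - c)) by ring.
rewrite ler_wpM2l ?(ltW h0)//; move: H; rewrite -/(dirichlet c d g).
have -> : - (2 * s) * (s * (d - c)) = - (2 * (s ^+ 2 * (d - c))) by ring.
lra.
Qed.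

(** Pointwise Poincare inequality: Cauchy-Schwarz on [c, x], then both factors are enlarged to
    [c, d]. *)
Lemma is_deriv_sqr_le c d w dw x : is_deriv c d w dw -> c <= x -> x <= d ->
  (w x - w c) ^+ 2 <= (d - c) * dirichlet c d dw.
Proof.
move=> H cx xd; have sw := is_deriv_sqint H.
rewrite (is_derivE H (lexx c) cx xd) addrAC subrr add0r.
apply: (le_trans (sqr_Rintegral_le cx (sqintS (lexx c) xd sw))).
apply: ler_pM; rewrite ?subr_ge0 ?dirichlet_ge0//; first by rewrite lerD2r.
exact: le_dirichletS.
Qed.

Lemma is_deriv_measurable c d w dw : c <= d -> is_deriv c d w dw ->
  measurable_fun `[c, d] w.
Proof.
move=> cd H; have iw := sqint_intg (is_deriv_sqint H).
apply: (@eq_measurable_fun _ _ _ _ _ (fun x => w c + Rintegral mu `[c, x] dw)).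
  by move=> x; rewrite inE/= in_itv/= => /andP[cx xd]; rewrite -(is_derivE H).
apply: measurable_funD => //.
apply: subspace_continuous_measurable_fun => //.
exact: (parameterized_integral_continuous cd iw).
Qed.

Lemma is_deriv_sqint0 c d w dw : c <= d -> is_deriv c d w dw -> sqint c d w.
Proof.
move=> cd H; have mw := is_deriv_measurable cd H.
apply: (sqint_dominated (g := fun=> 2 * ((d - c) * dirichlet c d dw) + 2 * w c ^+ 2)) => //.
  move=> x /andP[cx xd]; have := is_deriv_sqr_le H cx xd.
  (* This square is exactly the gap in w^2 <= 2 (w - w(c))^2 + 2 w(c)^2. *)
  have := sqr_ge0 (w x - 2 * w c); rewrite !sqrrB !mulr2n exprMn.
  by move: (_ * dirichlet _ _ _) => K; lra.
exact: intg_cst.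
Qed.

Lemma sqint_affineM c d p q g : sqint c d g -> sqint c d (fun x => (p + q * x) * g x).
Proof.
(* [M] bounds the affine factor on [c, d], where |x| <= |c| + |d|. *)
move=> [mg ig]; pose M : R := `|p| + `|q| * (`|c| + `|d|).
apply: (sqint_dominated (g := fun x => M ^+ 2 * g x ^+ 2)).
- apply: measurable_funM => //; apply: measurable_funD => //.
- move=> x /andP[cx xd]; rewrite exprMn ler_wpM2r ?sqr_ge0//.
  rewrite -(real_normK (num_real (p + q * x))) lerXn2r ?nnegrE//.
    by rewrite addr_ge0// mulr_ge0// addr_ge0.
  rewrite (le_trans (ler_normD _ _))// lerD2l normrM ler_wpM2l//.
  have := ler_norm d; have := ler_norm (- c); rewrite normrN.
  have := normr_ge0 d; have := normr_ge0 c; rewrite ler_norml => ? ? ? ?.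
  by apply/andP; split; lra.
- exact: intgZ.
Qed.

(* The product rule holds up to an increment of at most
   2 |q| (y - x) int_x^y |dw| on [x, y], hence exactly. *)
Lemma is_deriv_affineM c d p q w dw : c <= d -> is_deriv c d w dw ->
  is_deriv c d (fun x => (p + q * x) * w x)
               (fun x => q * w x + (p + q * x) * dw x).
Proof.
move=> cd H; pose g x := q * w x + (p + q * x) * dw x.
have sdw := is_deriv_sqint H; have idw := sqint_intg sdw.
have sw := is_deriv_sqint0 cd H.
have sg : sqint c d g by apply: sqintD; [exact: sqintZ|exact: sqint_affineM].
have ig := sqint_intg sg.
have indw : intg c d (fun x => `|dw x|) by exact: integrable_norm.
apply: sqint_is_deriv => // z /andP[cz zd].
(* [F] is the defect of the product formula and should be constant. [V] is the increasing function
   whose increments control it. *)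
pose F x := (p + q * x) * w x - Rintegral mu `[c, x] g.
pose V x := 2 * `|q| * Rintegral mu `[c, x] (fun t => `|dw t|).
suff : F z = F c.
  rewrite /F set_itv1 Rintegral_set1 subr0 => /eqP.
  by rewrite subr_eq => /eqP.
apply: (@eq_of_subquadratic_increments _ _ F V) => // x y cx xy yz.
have yd := le_trans yz zd; have xd := le_trans xy yd.
have cy := le_trans cx xy.
set A := Rintegral mu `[x, y] (fun t => `|dw t|).
have -> : V y - V x = 2 * `|q| * A.
  rewrite /V (Rintegral_chasles cx xy); last exact: intgS indw.
  rewrite -/A; ring.
have intgE f : intg c d f -> intg x y f by exact: intgS.
(* Discrete product rule: the increment of (p + q x) w is q (y - x) w(x) + (p + q y) (w(y) - w(x)).
   As an integrand this is [g] with w frozen at x and the affine factor frozen at y. *)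
have Fk : F y - F x =
    Rintegral mu `[x, y] (fun t => (q * w x + (p + q * y) * dw t) - g t).
  have i1 : intg x y (fun=> q * w x) by exact: intg_cst.
  have i2 : intg x y (fun t => (p + q * y) * dw t) by exact/intgE/intgZ.
  have i3 := intgD i1 i2; have i4 := intgE _ ig.
  rewrite RintegralB//.
  rewrite RintegralD// Rintegral_cst_itvcc// RintegralZl//; last exact: intgE.
  rewrite /F.
  rewrite (Rintegral_chasles cx xy); last exact: intgS ig.
  rewrite (is_derivE H cx xy yd); ring.
rewrite Fk.
have ik : intg x y (fun t => (q * w x + (p + q * y) * dw t) - g t).
  have ik' : intg x y (fun t => (q * w x + (p + q * y) * dw t) + (-1) * g t).
    apply: intgD; first by apply: intgD; [exact: intg_cst|exact/intgE/intgZ].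
    exact/intgE/intgZ.
  by apply: eq_integrable ik' => // t _ /=; rewrite mulN1r.
apply: (le_trans (le_normr_Rintegral _ ik)) => //.
have ib : intg x y (fun t => `|q| * (y - x) * `|dw t|) by exact/intgE/intgZ.
(* The two terms dominate the errors of freezing w (|w(x) - w(t)| <= A) and of freezing the affine
   factor (y - t <= y - x). Each integrates to |q| (y - x) A. *)
apply: (@le_trans _ _ (Rintegral mu `[x, y]
    (fun t => `|q| * A + `|q| * (y - x) * `|dw t|))); last first.
  rewrite RintegralD//; last exact: intg_cst.
  rewrite Rintegral_cst_itvcc// RintegralZl//; last exact: intgE.
  by rewrite -/A le_eqVlt; apply/orP; left; apply/eqP; ring.
apply: le_Rintegral => //.
- exact: integrable_norm.
- by apply: intgD => //; exact: intg_cst.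
move=> t /=; rewrite in_itv/= => /andP[xt ty].
have td := le_trans ty yd.
have -> : q * w x + (p + q * y) * dw t - g t =
    q * (w x - w t) + q * (y - t) * dw t by rewrite /g; ring.
rewrite (le_trans (ler_normD _ _))// !normrM lerD//; last first.
  rewrite ler_wpM2r// ler_wpM2l// ger0_norm ?subr_ge0//; lra.
rewrite ler_wpM2l// distrC (is_derivE H cx xt td) addrAC subrr add0r.
have idwt : intg x t dw by exact: intgS idw.
apply: (le_trans (le_normr_Rintegral _ idwt)) => //.
rewrite /A (Rintegral_chasles xt ty); last exact: intgE.
by rewrite lerDl Rintegral_ge0.
Qed.

(** The square of the sum costs a factor 2. Each of the two squares then contributes at most the
    energy of w: the first by Poincare, as w(c) = 0 and |q| (d - c) <= 1, the second since the
    affine factor is at most 1 in absolute value. *)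
Lemma dirichlet_affineM_le c d p q w dw : c <= d -> is_deriv c d w dw ->
  w c = 0 -> (forall x, c <= x <= d -> `|p + q * x| <= 1) ->
  `|q| * (d - c) <= 1 ->
  dirichlet c d (fun x => q * w x + (p + q * x) * dw x) <= 4 * dirichlet c d dw.
Proof.
move=> cd H wc l1 q1; set J := dirichlet c d dw.
have sdw := is_deriv_sqint H; have [mdw idw2] := sdw.
have sw := is_deriv_sqint0 cd H.
have [_ ig2] : sqint c d (fun x => q * w x + (p + q * x) * dw x).
  by apply: sqintD; [exact: sqintZ|exact: sqint_affineM].
have J0 : 0 <= J by exact: dirichlet_ge0.
have i2 : intg c d (fun x => 2 * dw x ^+ 2) by exact: intgZ.
apply: (@le_trans _ _ (Rintegral mu `[c, d]
    (fun x => 2 * q ^+ 2 * ((d - c) * J) + 2 * dw x ^+ 2))).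
  apply: le_Rintegral => //; first by apply: intgD => //; exact: intg_cst.
  move=> x /=; rewrite in_itv/= => /andP[cx xd].
  have wx : w x ^+ 2 <= (d - c) * J.
    by have := is_deriv_sqr_le H cx xd; rewrite wc subr0.
  have qw : (q * w x) ^+ 2 <= q ^+ 2 * ((d - c) * J).
    by rewrite exprMn ler_wpM2l ?sqr_ge0.
  have ld : ((p + q * x) * dw x) ^+ 2 <= dw x ^+ 2.
    rewrite exprMn ler_piMl ?sqr_ge0//.
    by rewrite -(real_normK (num_real (p + q * x))) expr_le1// l1// cx.
  move: qw ld (sqr_ge0 (q * w x - (p + q * x) * dw x)).
  rewrite sqrrB sqrrD !mulr2n.
  move: (q * w x) ((p + q * x) * dw x) => a b; lra.
rewrite RintegralD//; last exact: intg_cst.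
rewrite Rintegral_cst_itvcc// RintegralZl// -/(dirichlet c d dw) -/J.
have -> : 2 * q ^+ 2 * ((d - c) * J) * (d - c) = 2 * ((q * (d - c)) ^+ 2 * J) by ring.
have : (q * (d - c)) ^+ 2 * J <= J.
  rewrite ler_piMl// -(real_normK (num_real (q * (d - c)))) expr_le1// normrM.
  by rewrite (ger0_norm (_ : 0 <= d - c)) ?subr_ge0.
lra.
Qed.

(** * Gluing weak derivatives at a point *)

Lemma sqint_restrict c d x y (D : set R) g : measurable D -> D `<=` `[x, y] ->
  sqint x y g -> sqint c d (g \_ D).
Proof.
move=> mD Dxy [mg ig]; split.
  apply/measurable_restrict => //.
  by apply: measurable_funS mg => // z [_ /Dxy].
rewrite (_ : (fun z => _) = (fun z => g z ^+ 2) \_ D); last first.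
  by apply/funext => z; rewrite !patchE; case: ifP => //; rewrite expr0n.
rewrite -restrict_EFin; apply/integrable_restrict => //.
by apply: integrableS ig => //; [exact: measurableI|move=> z [_ /Dxy]].
Qed.

Lemma is_deriv_glue c m d u g1 g2 : c <= m -> m <= d ->
  is_deriv c m u g1 -> is_deriv m d u g2 ->
  exists g, is_deriv c d u g /\
    dirichlet c d g = dirichlet c m g1 + dirichlet m d g2.
Proof.
move=> cm md H1 H2; pose g x := if x <= m then g1 x else g2 x.
have s1 := is_deriv_sqint H1; have s2 := is_deriv_sqint H2.
have gE1 x : c <= x <= m -> g1 x = g x by rewrite /g => /andP[_ ->].
have sg : sqint c d g.
  apply: (eq_sqint (f := fun x => (g1 \_ `[c, m]) x + (g2 \_ `]m, d]) x)).
    move=> x /andP[cx xd]; rewrite /g !patchE !mem_setE !in_itv/= cx xd andbT/=.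
    by case: leP => _; rewrite ?addr0 ?add0r.
  apply: sqintD; first by apply: sqint_restrict s1.
  apply: sqint_restrict s2 => // z /=; rewrite !in_itv/= => /andP[mz ->].
  by rewrite ltW.
have ig := sqint_intg sg; have [_ ig2] := sg.
(* At m the glued [g] takes the value of [g1], so the left endpoint is dropped before comparing with
   [g2]. [F] is used as the identity and as the square. *)
have gE2 (F : R -> R) x : m <= x -> x <= d ->
    intg c d (fun t => F (g t)) -> intg m x (fun t => F (g2 t)) ->
    Rintegral mu `[m, x] (fun t => F (g t)) = Rintegral mu `[m, x] (fun t => F (g2 t)).
  move=> mx xd i1 i2; rewrite -!Rintegral_itv_obnd_cbnd.
  - apply: eq_Rintegral => z; rewrite inE/= in_itv/= => /andP[mz _].
    by rewrite /g leNgt mz.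
  - apply: integrableS i2 => // z /=; rewrite !in_itv/= => /andP[mz ->].
    by rewrite ltW.
  - apply: integrableS i1 => // z /=; rewrite !in_itv/= => /andP[mz zx].
    by rewrite (le_trans cm (ltW mz)) (le_trans zx).
exists g; split; last first.
  rewrite (dirichlet_chasles cm md sg) -(eq_dirichlet gE1); congr (_ + _).
  by apply: (gE2 (fun t => t ^+ 2)) => //; case: s2.
apply: sqint_is_deriv => // x /andP[cx xd].
have [xm|/ltW mx] := leP x m.
  rewrite (is_derivE H1 (lexx c) cx xm); congr (_ + _).
  apply: eq_Rintegral => z; rewrite inE/= in_itv/= => /andP[cz zx].
  by apply: gE1; rewrite cz (le_trans zx).
rewrite (is_derivE H2 (lexx m) mx xd) (is_derivE H1 (lexx c) cm (lexx m)).
rewrite (Rintegral_chasles cm mx); last exact: intgS ig.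
rewrite (gE2 (fun t => t))//; last by apply: intgS (sqint_intg s2).
rewrite addrA; congr (_ + _ + _).
by apply: eq_Rintegral => z; rewrite inE/= in_itv/=; exact: gE1.
Qed.

(** * Uniqueness of weak derivatives and the energy norm *)

Lemma is_deriv_ae_unique c d u g1 g2 : is_deriv c d u g1 -> is_deriv c d u g2 ->
  {ae mu, forall x, c < x < d -> g1 x = g2 x}.
Proof.
(* The difference [g] has a vanishing indefinite integral on [c, d], so Lebesgue differentiation
   makes it vanish almost everywhere. *)
move=> H1 H2; pose g x := g1 x + (-1) * g2 x.
have sg : sqint c d g.
  by apply: sqintD (is_deriv_sqint H1) (sqintZ _ (is_deriv_sqint H2)).
have i1 := sqint_intg (is_deriv_sqint H1).
have i2 := sqint_intg (is_deriv_sqint H2).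
have ig := sqint_intg sg.
have g0 x : c <= x -> x <= d -> Rintegral mu `[c, x] g = 0.
  move=> cx xd; have {}i1 := intgS (lexx c) xd i1.
  have {}i2 := intgS (lexx c) xd i2.
  rewrite RintegralD//; last exact: intgZ.
  rewrite RintegralZl//.
  have := is_derivE H1 (lexx c) cx xd; rewrite (is_derivE H2 (lexx c) cx xd).
  by move=> /addrI ->; rewrite mulN1r subrr.
(* Extended by zero, [g] has an identically zero primitive on the whole line, as [FTC1] quantifies
   over all upper limits. *)
pose f := g \_ `[c, d].
have iF y : mu.-integrable [set` Interval (BLeft c) (BRight y)] (EFin \o f).
  rewrite /f -restrict_EFin; apply/integrable_restrict => //.
  by apply: integrableS ig => //; exact: measurableI.
have := FTC1 iF (integrable_locally (measurable_itv _) ig).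
have -> : (fun x => Rintegral mu [set` Interval (BLeft c) (BRight x)] f) = cst 0.
  apply/funext => x; rewrite /f -Rintegral_mkcondr.
  have [xc|cx] := ltP x c.
    rewrite (_ : _ `&` _ = set0) ?Rintegral_set0//; apply/seteqP; split=> // z [].
    by rewrite /= in_itv/= => /andP[/le_trans H /H]; rewrite leNgt xc.
  have [xd|/ltW dx] := leP x d.
    by rewrite setIidl ?g0//; apply: sub_itvcc.
  have [dc|cd] := ltP d c.
    rewrite (_ : _ `&` _ = set0) ?Rintegral_set0//; apply/seteqP; split=> // z [] _.
    by rewrite /= in_itv/= => /andP[/le_trans H /H]; rewrite leNgt dc.
  by rewrite setIidr ?g0//; apply: sub_itvcc.
apply: filterS; first exact: (ae_filter_ringOfSetsType mu).
move=> x /= H /andP[cx xd].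
have [|_] := H _; first by rewrite lte_fin.
rewrite derive1E derive_cst /f patchE mem_set; last by rewrite /= in_itv/= !ltW.
by rewrite /g mulN1r => /esym/eqP; rewrite subr_eq0 => /eqP.
Qed.

Lemma Rintegral_itvoo_itvcc c d f : intg c d f ->
  Rintegral mu `]c, d[ f = Rintegral mu `[c, d] f.
Proof.
move=> fi.
rewrite Rintegral_itv_bndo_bndc; last first.
  by apply: integrableS fi => //; exact: subset_itv_oo_cc.
rewrite Rintegral_itv_obnd_cbnd//.
by apply: integrableS fi => //; exact: subset_itv_oc_cc.
Qed.

(** This lets any convenient derivative replace the one picked by [dchoose]; the endpoints, where
    uniqueness says nothing, have measure zero. *)
Lemma eq_dirichlet_is_deriv c d u g1 g2 :
  is_deriv c d u g1 -> is_deriv c d u g2 -> dirichlet c d g1 = dirichlet c d g2.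
Proof.
move=> H1 H2; have [_ i1] := is_deriv_sqint H1; have [_ i2] := is_deriv_sqint H2.
rewrite /dirichlet -!Rintegral_itvoo_itvcc// /Rintegral; congr fine.
have sub : (`]c, d[ : set R) `<=` `[c, d] by exact: subset_itv_oo_cc.
apply: ae_eq_integral => //.
- by have /measurable_int := i1; apply: measurable_funS.
- by have /measurable_int := i2; apply: measurable_funS.
apply: filterS (is_deriv_ae_unique H1 H2).
  exact: (ae_filter_ringOfSetsType mu).
move=> x g12.
by rewrite /= in_itv/= => /g12 ->.
Qed.

Lemma H1_dchoose c d u : H1 c d u -> is_deriv c d u (dchoose c d u).
Proof. by move=> Hu; apply: (@xgetPex _ _ [set du | is_deriv c d u du]). Qed.

Lemma Enorm_ge0 a c d w : 0 <= Enorm a c d w.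
Proof. exact: sqrtr_ge0. Qed.

(** The passage between the two energies: the lower bound is applied on the patches, the upper one
    on the whole interval. *)
Lemma Enorm_bounds (a : R -> R) c d w dw (lo hi : R) : 0 <= lo ->
  measurable_fun `]c, d[ a -> (forall x, c < x < d -> lo <= a x <= hi) ->
  is_deriv c d w dw ->
  lo * dirichlet c d dw <= Enorm a c d w ^+ 2 <= hi * dirichlet c d dw.
Proof.
move=> lo0 ma ab H; have Hc : is_deriv c d w (dchoose c d w).
  by apply: H1_dchoose; exists dw.
rewrite (eq_dirichlet_is_deriv H Hc); set g := dchoose c d w in Hc *.
have [mg ig] := is_deriv_sqint Hc.
have sub : (`]c, d[ : set R) `<=` `[c, d] by exact: subset_itv_oo_cc.
have iz r : mu.-integrable `]c, d[ (EFin \o (fun x => r * g x ^+ 2)).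
  by apply: integrableS (intgZ r ig).
have a0 x : c < x < d -> 0 <= a x by move=> /ab/andP[/(le_trans lo0)].
have ia : mu.-integrable `]c, d[ (EFin \o (fun x => a x * g x ^+ 2)).
  apply: le_integrable (iz hi) => //.
    apply/measurable_EFinP/measurable_funM => //.
    by apply/measurable_funX; exact: measurable_funS mg.
  move=> x /=; rewrite in_itv/= lee_fin !normrM => xcd.
  have /andP[_ ah] := ab _ xcd.
  by rewrite ler_wpM2r// !ger0_norm ?a0// (le_trans (a0 _ xcd)).
have -> : Enorm a c d w ^+ 2 = Rintegral mu `]c, d[ (fun x => a x * g x ^+ 2).
  rewrite /Enorm sqr_sqrtr// fine_ge0// integral_ge0// => x /=.
  by rewrite in_itv/= lee_fin => xcd; rewrite mulr_ge0 ?sqr_ge0 ?a0.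
have dE r : r * dirichlet c d g = Rintegral mu `]c, d[ (fun x => r * g x ^+ 2).
  rewrite /dirichlet -RintegralZl// Rintegral_itvoo_itvcc//; exact: intgZ.
rewrite !dE; apply/andP; split; apply: le_Rintegral => // x /=; rewrite in_itv/=.
  by move=> /ab/andP[? _]; rewrite ler_wpM2r ?sqr_ge0.
by move=> /ab/andP[_ ?]; rewrite ler_wpM2r ?sqr_ge0.
Qed.

Lemma is_deriv_point c u : is_deriv c c u (fun=> 0).
Proof.
apply: sqint_is_deriv; first exact: sqint_cst.
by move=> x /le_anti <-; rewrite set_itv1 Rintegral_set1 addr0.
Qed.

(** * Hat functions and patch interpolants *)

Section mesh.
Variable N : nat.
Hypothesis N0 : (0 < N)%N.
Local Notation nd k := (@node R N k).

Let NR : 0 < N%:R :> R. Proof. by rewrite ltr0n. Qed.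

Lemma node0 : nd 0 = 0. Proof. by rewrite /node mul0r. Qed.

Lemma nodeN : nd N = 1. Proof. by rewrite /node divff// gt_eqF. Qed.

Lemma le_node j k : (j <= k)%N -> nd j <= nd k.
Proof. by move=> jk; rewrite ler_pM2r ?invr_gt0// ler_nat. Qed.

Lemma plo_ge0 i : 0 <= @plo R N i.
Proof. by rewrite -node0 le_node. Qed.

Lemma phi__le1 i : @phi_ R N i <= 1.
Proof. by rewrite -nodeN le_node// geq_minr. Qed.

Lemma le_plo_phi_ i : (i <= N)%N -> @plo R N i <= phi_ N i.
Proof.
by move=> iN; rewrite le_node// leq_min (leq_trans (leq_pred _))//=;
  exact: leq_trans (leq_pred _) iN.
Qed.

(** Scaling by N moves the nodes to the integers, which makes the case analyses below linear
    arithmetic. *)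
Lemma hatE k x : hat N k x = Num.max 0 (1 - `|x * N%:R - k%:R|).
Proof.
rewrite /hat -[N%:R in LHS]gtr0_norm// -normrM mulrBl.
by rewrite /node divfK// gt_eqF.
Qed.

Lemma node_itvE k x :
  (nd k <= x <= nd k.+1) = (k%:R <= x * N%:R <= k%:R + 1).
Proof. by rewrite natr1 /node ler_pdivrMr// ler_pdivlMr. Qed.

(** The shape p + q x is the one that [is_deriv_affineM] expects. *)
Lemma hat_left k x : nd k <= x <= nd k.+1 ->
  hat N k x = k.+1%:R + (- N%:R) * x.
Proof.
rewrite node_itvE hatE => /andP[kx xk]; rewrite ger0_norm ?subr_ge0//.
by rewrite max_r -?natr1; [ring|lra].
Qed.

Lemma hat_right k x : nd k <= x <= nd k.+1 ->
  hat N k.+1 x = - k%:R + N%:R * x.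
Proof.
rewrite node_itvE hatE -natr1 => /andP[kx xk]; rewrite ler0_norm; last lra.
by rewrite max_r; [ring|lra].
Qed.

Lemma hat_out k j x : nd k <= x <= nd k.+1 -> j != k -> j != k.+1 ->
  hat N j x = 0.
Proof.
rewrite node_itvE hatE => /andP[kx xk].
case: (ltngtP j k) => // jk _.
  have : j.+1%:R <= k%:R :> R by rewrite ler_nat.
  rewrite -natr1 => jk1 _; rewrite ger0_norm; last lra.
  by rewrite max_l//; lra.
rewrite neq_ltn ltnNge jk/= => jk1.
have : k.+2%:R <= j%:R :> R by rewrite ler_nat.
rewrite -addn2 natrD => jk2; rewrite ler0_norm; last lra.
by rewrite max_l//; lra.
Qed.

Lemma hatD k x : nd k <= x <= nd k.+1 -> hat N k x + hat N k.+1 x = 1.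
Proof. by move=> xk; rewrite hat_left// hat_right// -natr1; ring. Qed.

Lemma sum_hat (e : nat -> R) (m n k : nat) x : nd k <= x <= nd k.+1 ->
  (m <= k)%N -> (k.+1 < n)%N ->
  \sum_(m <= j < n) e j * hat N j x = e k * hat N k x + e k.+1 * hat N k.+1 x.
Proof.
move=> xk mk kn.
rewrite (big_cat_nat (n := k) mk)//=; last exact: ltnW (ltnW kn).
rewrite big_nat big1 ?add0r; last first.
  move=> j /andP[_ jk]; rewrite (hat_out xk) ?mulr0//; rewrite neq_ltn ?jk//.
  by rewrite ltnS ltnW.
rewrite big_ltn; last by rewrite ltnW.
rewrite big_ltn//; congr (_ + _).
rewrite big_nat big1 ?addr0// => j /andP[jk _].
by rewrite (hat_out xk) ?mulr0//; rewrite neq_ltn ?jk ?(ltnW jk) orbT.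
Qed.

(** The index bounds place the element inside the patch of i; the right-hand side is free of i, so
    all patches containing the element share one interpolant there. *)
Lemma Ipatch_elt i k u x : (i.-1 <= k)%N -> (k < minn i.+1 N)%N ->
  nd k <= x <= nd k.+1 ->
  Ipatch N i u x = u (nd k) * hat N k x + u (nd k.+1) * hat N k.+1 x.
Proof.
by move=> ik ki xk; rewrite /Ipatch (sum_hat (fun j => u (nd j)) xk)// ltnS.
Qed.

Lemma Ipatch_node i j u : (i <= N)%N -> (i.-1 <= j <= minn i.+1 N)%N ->
  Ipatch N i u (nd j) = u (nd j).
Proof.
(* The last vertex of the patch has no element of the patch to its right, so it is read as the right
   end of the preceding element; every other vertex is a left end. *)
move=> iN /andP[ij]; rewrite leq_eqVlt => /orP[/eqP jm|jm].
  have ij' : (i <= j)%N by rewrite jm leq_min leqnSn.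
  have j0 : (0 < j)%N by rewrite jm leq_min.
  case: j j0 ij ij' jm => // j _ _ ij jm.
  have xj : nd j <= nd j.+1 <= nd j.+1 by rewrite lexx le_node.
  have ij1 : (i.-1 <= j)%N by rewrite -subn1 leq_subLR add1n.
  have jm1 : (j < minn i.+1 N)%N by rewrite -jm.
  rewrite (@Ipatch_elt i j)// hat_left// hat_right//.
  rewrite mulNr [N%:R * _]mulrC divfK ?gt_eqF// -natr1; ring.
have xj : nd j <= nd j <= nd j.+1 by rewrite lexx le_node.
rewrite (@Ipatch_elt i j)// hat_left// hat_right//.
rewrite mulNr [N%:R * _]mulrC divfK ?gt_eqF// -natr1; ring.
Qed.

(** Induction on the number of elements. The bounds add up because gluing adds the Dirichlet
    integrals exactly. *)
Lemma is_deriv_nodes (B : nat -> R) u (m n : nat) : (m <= n)%N ->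
  (forall k, (m <= k < n)%N -> exists g,
     is_deriv (nd k) (nd k.+1) u g /\ dirichlet (nd k) (nd k.+1) g <= B k) ->
  exists g, is_deriv (nd m) (nd n) u g /\
            dirichlet (nd m) (nd n) g <= \sum_(m <= k < n) B k.
Proof.
elim: n => [|n IH]; rewrite leq_eqVlt => /orP[/eqP ->|] //.
- move=> _; exists (fun=> 0); split; first exact: is_deriv_point.
  by rewrite big_geq// /dirichlet set_itv1 Rintegral_set1.
- move=> _; exists (fun=> 0); split; first exact: is_deriv_point.
  by rewrite big_geq// /dirichlet set_itv1 Rintegral_set1.
rewrite ltnS => mn H.
have [|g1 [H1 J1]] := IH mn.
  by move=> k /andP[mk kn]; apply: H; rewrite mk ltnS ltnW.
have [|g2 [H2 J2]] := H n; first by rewrite mn /=.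
have [g [Hg Jg]] := is_deriv_glue (le_node mn) (le_node (leqnSn n)) H1 H2.
by exists g; split=> //; rewrite big_nat_recr//= Jg lerD.
Qed.

Lemma H1_nodes u (m n : nat) : (m <= n)%N ->
  (forall k, (m <= k < n)%N -> H1 (nd k) (nd k.+1) u) -> H1 (nd m) (nd n) u.
Proof.
move=> mn H.
(* Any bound will do here, so each element gets the energy of its own chosen derivative. *)
have [|g [Hg _]] := @is_deriv_nodes
  (fun k => dirichlet (nd k) (nd k.+1) (dchoose (nd k) (nd k.+1) u)) u m n mn.
  move=> k /H Hk; exists (dchoose (nd k) (nd k.+1) u); split=> //.
  exact: H1_dchoose.
by exists g.
Qed.

Lemma H1_hat (m n : nat) j : (m <= n)%N -> H1 (nd m) (nd n) (hat N j).
Proof.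
move=> mn; apply: H1_nodes => // k _.
have aff p q : (forall x, nd k <= x <= nd k.+1 -> hat N j x = p + q * x) ->
    H1 (nd k) (nd k.+1) (hat N j).
  move=> E; apply: (eq_H1 (u := fun x => p + q * x)).
  - exact: le_node.
  - by move=> x /E.
  - by exists (fun=> q); exact: is_deriv_affine.
have [jk|jk] := eqVneq j k; first by rewrite jk in aff *; apply: aff; exact: hat_left.
have [jk1|jk1] := eqVneq j k.+1.
  by rewrite jk1 in aff *; apply: aff; exact: hat_right.
by apply: (aff 0 0) => x xk; rewrite (hat_out xk)// mul0r addr0.
Qed.

Lemma H1_Ipatch i u : (i <= N)%N -> H1 (plo N i) (phi_ N i) (Ipatch N i u).
Proof.
move=> iN; apply: H1_sum => k _; apply: H1Z; apply: H1_hat.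
by rewrite leq_min (leq_trans (leq_pred _))//=; exact: leq_trans (leq_pred _) iN.
Qed.

(** On an element both hats are affine with slope of absolute value N, the inverse of its length, so
    [dirichlet_affineM_le] applies to each product. The constant 8 is its 4 times the 2 from
    splitting the sum. *)
Lemma is_deriv_hat_blend k (w1 w2 d1 d2 : R -> R) :
  is_deriv (nd k) (nd k.+1) w1 d1 -> is_deriv (nd k) (nd k.+1) w2 d2 ->
  w1 (nd k) = 0 -> w2 (nd k) = 0 ->
  exists g,
    is_deriv (nd k) (nd k.+1)
      (fun x => hat N k x * w1 x + hat N k.+1 x * w2 x) g /\
    dirichlet (nd k) (nd k.+1) g <=
      8 * (dirichlet (nd k) (nd k.+1) d1 + dirichlet (nd k) (nd k.+1) d2).
Proof.
move=> H1 H2 z1 z2; have kk := le_node (leqnSn k).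
have q1 : `|N%:R| * (nd k.+1 - nd k) <= 1.
  by rewrite gtr0_norm// /node -mulrBl -natr1 addrAC subrr add0r mul1r divff ?gt_eqF.
have b1 x : nd k <= x <= nd k.+1 -> `|k.+1%:R + (- N%:R) * x| <= 1.
  rewrite node_itvE -natr1 => /andP[kx xk].
  by rewrite mulNr [N%:R * _]mulrC ler_norml; apply/andP; split; lra.
have b2 x : nd k <= x <= nd k.+1 -> `|- k%:R + N%:R * x| <= 1.
  rewrite node_itvE => /andP[kx xk].
  by rewrite [N%:R * _]mulrC ler_norml; apply/andP; split; lra.
have J1 := dirichlet_affineM_le kk H1 z1 b1.
have J2 := dirichlet_affineM_le kk H2 z2 b2 q1.
have {}J1 := J1 (eq_ind_r (fun r => r * _ <= 1) q1 (normrN _)).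
have {}H1 := is_deriv_affineM k.+1%:R (- N%:R) kk H1.
have {}H2 := is_deriv_affineM (- k%:R) N%:R kk H2.
eexists; split.
  apply: eq_is_deriv (is_derivD H1 H2) => //.
  by move=> x xk /=; rewrite hat_left// hat_right.
apply: le_trans (dirichletD_le (is_deriv_sqint H1) (is_deriv_sqint H2)) _.
lra.
Qed.

Lemma inVbar_H1 n (phi : nat -> nat -> R -> R) i xi : (i <= N)%N ->
  (forall j, (j <= n i)%N -> H1 (plo N i) (phi_ N i) (phi i j)) ->
  inVbar N n phi i xi -> H1 (plo N i) (phi_ N i) xi.
Proof.
move=> iN Hphi [e E].
apply: eq_H1 (le_plo_phi_ iN) (fun x xi => esym (E x xi)) _.
(* The index range is kept as a condition, since the basis functions are known to be H1 only for j
   <= n i. *)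
under eq_fun do rewrite big_nat_cond.
apply: H1_sum => j; rewrite andbT ltnS => /andP[_ jn].
by apply/H1Z/H1B; [exact: Hphi|exact: H1_Ipatch].
Qed.

Lemma inVbar_node n (phi : nat -> nat -> R -> R) i j xi : (i <= N)%N -> (i.-1 <= j <= minn i.+1 N)%N ->
  inVbar N n phi i xi -> xi (nd j) = 0.
Proof.
move=> iN ij [e E]; rewrite E; last first.
  by case/andP: ij => ij ji; rewrite !le_node.
by rewrite big1// => l _; rewrite Ipatch_node// subrr mulr0.
Qed.

Lemma sum_adjacent_le (D : nat -> R) : (forall i, 0 <= D i) ->
  \sum_(0 <= k < N) (D k + D k.+1) <= 2 * \sum_(0 <= i < N.+1) D i.
Proof.
move=> D0; rewrite big_split/= mulr2n mulrDl mul1r lerD//.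
  by rewrite big_nat_recr//= lerDl.
by rewrite big_nat_recl//= lerDr.
Qed.

End mesh.
End calculus.

(** * Assembly of the global approximation and the error estimate *)

Theorem mainTheorem1 (R : realType) (alpha beta C1 : R) :
  0 < alpha -> alpha <= beta -> 0 < C1 ->
  exists C : R,
  forall (a u : R -> R) (N : nat) (n : nat -> nat) (phi : nat -> nat -> R -> R)
         (xi : nat -> R -> R) (eps : nat -> R),
    measurable_fun (`]0, 1[ : set R) a ->
    (forall x, 0 < x < 1 -> alpha <= a x <= beta) ->
    (0 < N)%N ->
    H1 0 1 u -> u 0 = 0 ->
    (forall i j, (i <= N)%N -> (j <= n i)%N ->
       H1 (plo N i) (phi_ N i) (phi i j)) ->
    (forall i, (i <= N)%N -> inT2 N n phi i ->
       [/\ inVbar N n phi i (xi i), 0 <= eps i,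
           L2norm (plo N i) (phi_ N i)
             (fun x => u x - Ipatch N i u x - xi i x)
           <= C1 * diam N i * Enorm a (plo N i) (phi_ N i)
                  (fun x => u x - Ipatch N i u x - xi i x) &
           Enorm a (plo N i) (phi_ N i)
             (fun x => u x - Ipatch N i u x - xi i x) <= eps i]) ->
    exists v : R -> R,
      inS N n phi v /\ H1 0 1 v /\
      Enorm a 0 1 (fun x => u x - v x)
      <= C * Num.sqrt
           (\sum_(0 <= i < N.+1 | ~~ `[< inT2 N n phi i >])
               Enorm a (plo N i) (phi_ N i) (fun x => u x - Ipatch N i u x) ^+ 2
            + \sum_(0 <= i < N.+1 | `[< inT2 N n phi i >]) eps i ^+ 2).
Proof.
(* 16 is the 8 of [is_deriv_hat_blend] times the 2 of [sum_adjacent_le]; beta comes from the global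
   energy and 1/alpha from the patch energies. *)
move=> alpha0 alphabeta _; exists (Num.sqrt (16 * beta / alpha)).
move=> a u N n phi xi eps ma ab N0 Hu u0 Hphi Hxi.
pose T i := `[< inT2 N n phi i >].
have HT i : (i <= N)%N -> T i -> [/\ inVbar N n phi i (xi i), 0 <= eps i &
    Enorm a (plo N i) (phi_ N i) (fun x => u x - Ipatch N i u x - xi i x) <= eps i].
  by move=> iN /asboolP /(Hxi _ iN)[].
(* Zero local corrections off T2 let all patches be treated alike; [S] collects the matching error
   terms. *)
pose z i : R -> R := if T i then xi i else fun=> 0.
pose w i x := u x - Ipatch N i u x - z i x.
pose S i := if T i then eps i ^+ 2 else
  Enorm a (plo N i) (phi_ N i) (fun x => u x - Ipatch N i u x) ^+ 2.
pose v x := \sum_(1 <= i < N.+1) u (node N i) * hat N i x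
          + \sum_(0 <= i < N.+1 | `[< inT2 N n phi i >])
               (if plo N i < x < phi_ N i then hat N i x * xi i x else 0).
have z0 i j : (i <= N)%N -> (i.-1 <= j <= minn i.+1 N)%N -> z i (node N j) = 0.
  move=> iN ij; rewrite /z; case: ifP => // /(HT _ iN)[Vi _ _].
  exact: (inVbar_node N0 iN ij Vi).
have w0 i j : (i <= N)%N -> (i.-1 <= j <= minn i.+1 N)%N -> w i (node N j) = 0.
  by move=> iN ij; rewrite /w z0// Ipatch_node// !subrr.
have Hw i : (i <= N)%N -> H1 (plo N i) (phi_ N i) (w i).
  move=> iN; apply: H1B; first apply: H1B.
  - exact: (H1S (@plo_ge0 R N N0 i) (@phi__le1 R N N0 i) Hu).
  - exact: H1_Ipatch.
  - rewrite /z; case: ifP => [/(HT _ iN)[Vi _ _]|_].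
      by apply: (inVbar_H1 N0 iN _ Vi) => j; exact: Hphi.
    exists (fun=> 0); have := is_deriv_affine (plo N i) (phi_ N i) (0 : R) 0.
    by rewrite (_ : (fun x : R => _) = fun=> 0)//; apply/funext => x; rewrite mul0r addr0.
pose dw i := dchoose (plo N i) (phi_ N i) (w i).
have Hdw i : (i <= N)%N -> is_deriv (plo N i) (phi_ N i) (w i) (dw i).
  by move=> iN; apply/H1_dchoose/Hw.
pose D i := dirichlet (plo N i) (phi_ N i) (dw i).
(* The patch energy of [w i] lies between: it is at least alpha times [D i], at most [eps i] before
   squaring on T2, and the interpolation error itself off T2. *)
have DS i : (i <= N)%N -> alpha * D i <= S i.
  move=> iN; apply: (@le_trans _ _ (Enorm a (plo N i) (phi_ N i) (w i) ^+ 2)).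
    have sub (x : R) : plo N i < x < phi_ N i -> 0 < x < 1.
      move=> /andP[px xp]; rewrite (le_lt_trans (@plo_ge0 R N N0 i) px).
      exact: lt_le_trans (@phi__le1 R N N0 i).
    suff /andP[] : alpha * D i <= Enorm a (plo N i) (phi_ N i) (w i) ^+ 2 <= beta * D i by [].
    apply: Enorm_bounds (ltW alpha0) _ _ (Hdw i iN).
    - by apply: measurable_funS ma => // x /=; rewrite !in_itv/=; exact: sub.
    - by move=> x /sub; exact: ab.
  rewrite /S /w /z; case: ifP => [/(HT _ iN)[_ e0 He]|_].
    by rewrite lerXn2r ?nnegrE ?Enorm_ge0.
  by under eq_fun do rewrite subr0.
have uv k x : (k < N)%N -> node N k <= x <= node N k.+1 ->
    u x - v x = hat N k x * w k x + hat N k.+1 x * w k.+1 x.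
  move=> kN xk; have kN' := ltnW kN.
  (* The hat at node 0 may be added because u(0) = 0, and the cut-off at the patch boundary may be
     removed because the dropped products vanish. *)
  have -> : v x = \sum_(0 <= i < N.+1) u (node N i) * hat N i x
                + \sum_(0 <= i < N.+1) z i x * hat N i x.
    rewrite /v; congr (_ + _).
      by rewrite [RHS]big_nat_recl//= node0 u0 mul0r add0r big_add1.
    rewrite big_mkcond; apply: eq_big_nat => i; rewrite ltnS => /= iN.
    rewrite -/(T i) /z; case: ifP => Ti; last by rewrite mul0r.
    case: ifP => [_|/negbT xi0]; first by rewrite mulrC.
    have [Vi _ _] := HT _ iN Ti.
    (* A point of the closed patch outside the open one is an end vertex, where the local function
       vanishes. This settles i = k and i = k + 1, whose closed patches contain the element; any
       other hat vanishes on it. *)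
    have edge : plo N i <= x <= phi_ N i -> xi i x = 0.
      move=> /andP[px xp]; move: xi0; rewrite negb_and -!leNgt => /orP[xp'|xp'].
        have -> : x = node N i.-1 by apply/le_anti; rewrite xp' px.
        apply: (inVbar_node N0 iN _ Vi).
        by rewrite leqnn leq_min !(leq_trans (leq_pred _)).
      have -> : x = node N (minn i.+1 N) by apply/le_anti; rewrite xp' xp.
      apply: (inVbar_node N0 iN _ Vi).
      by rewrite leqnn leq_min !(leq_trans (leq_pred _)).
    have [ik|ik] := eqVneq i k.
      rewrite edge ?mul0r//; case/andP: xk => kx xk; apply/andP; split.
        by apply: le_trans kx; rewrite le_node// ik leq_pred.
      by apply: (le_trans xk); rewrite le_node// leq_min ik ltnS leqnn.
    have [ik1|ik1] := eqVneq i k.+1.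
      rewrite edge ?mul0r//; case/andP: xk => kx xk; apply/andP; split.
        by apply: le_trans kx; rewrite le_node// ik1.
      by apply: (le_trans xk); rewrite le_node// leq_min ik1 kN leqnSn.
    by rewrite (hat_out N0 xk ik ik1) mulr0.
  rewrite (sum_hat N0 (fun i => u (node N i)) xk)//.
  rewrite (sum_hat N0 (fun i => z i x) xk)// /w.
  rewrite !(@Ipatch_elt R N N0 _ k)//; first last.
  - by rewrite leq_min ltnSn.
  - exact: leq_pred.
  - by rewrite leq_min kN andbT ltnW.
  (* Partition of unity: N_k is replaced by 1 - N_(k+1), after which both sides agree as
     polynomials. *)
  have := hatD N0 xk; move/eqP; rewrite eq_sym -subr_eq => /eqP <-; ring.
have [|g [Hg Jg]] := @is_deriv_nodes R N N0 (fun k => 8 * (D k + D k.+1))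
    (fun x => u x - v x) 0 N (leq0n N).
  move=> k /andP[_ kN]; have kN' := ltnW kN.
  have sk : node N k <= node N k.+1 :> R by rewrite le_node.
  have lk : (plo N k : R) <= node N k by rewrite le_node// leq_pred.
  have rk : (node N k.+1 : R) <= phi_ N k by rewrite le_node// leq_min ltnSn.
  have lk1 : (plo N k.+1 : R) <= node N k by [].
  have rk1 : (node N k.+1 : R) <= phi_ N k.+1 by rewrite le_node// leq_min leqnSn.
  have [g [Hg Jg]] := is_deriv_hat_blend N0 (is_derivS lk rk (Hdw k kN'))
    (is_derivS lk1 rk1 (Hdw k.+1 kN))
    (w0 k k kN' ltac:(by rewrite leq_pred leq_min leqnSn))
    (w0 k.+1 k kN ltac:(by rewrite leqnn leq_min kN' (leq_trans (leqnSn k)))).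
  exists g; split.
    by apply: eq_is_deriv Hg => // x xk; rewrite (uv k).
  apply: (le_trans Jg); rewrite ler_wpM2l//; apply: lerD.
    by apply: le_dirichletS => //; exact: is_deriv_sqint (Hdw k kN').
  by apply: le_dirichletS => //; exact: is_deriv_sqint (Hdw k.+1 kN).
rewrite node0 nodeN// in Hg Jg.
exists v; split; [|split].
- exists (fun i => u (node N i)), xi; split=> // i iN.
  by case/(Hxi _ iN).
(* v is u minus the error, and the error was just glued into an H1 function. *)
- have := H1B Hu (ex_intro _ g Hg : H1 0 1 (fun x => u x - v x)).
  by rewrite (_ : (fun x => _) = v)//; apply/funext => x; rewrite opprB addrC subrK.
have D0 i : 0 <= D i by exact: dirichlet_ge0.
have /andP[_ Euv] := Enorm_bounds (ltW alpha0) ma ab Hg.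
have beta0 : 0 <= beta by rewrite (le_trans (ltW alpha0)).
have Esum : \sum_(0 <= i < N.+1) S i =
    \sum_(0 <= i < N.+1 | ~~ `[< inT2 N n phi i >])
       Enorm a (plo N i) (phi_ N i) (fun x => u x - Ipatch N i u x) ^+ 2
    + \sum_(0 <= i < N.+1 | `[< inT2 N n phi i >]) eps i ^+ 2.
  rewrite (bigID T)/= addrC; congr (_ + _); apply: eq_bigr => i; rewrite /S.
    by move=> /negbTE ->.
  by move=> ->.
rewrite -Esum -sqrtrM; last by rewrite divr_ge0 ?mulr_ge0// ltW.
rewrite -[leLHS]ger0_norm ?Enorm_ge0// -sqrtr_sqr ler_wsqrtr//.
apply: (le_trans Euv).
rewrite -!mulrA mulrCA ler_wpM2l// mulrA.
apply: (le_trans Jg).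
(* With beta cancelled, the chain is 8 sum (D_k + D_(k+1)) <= 16 sum D_i <= (16 / alpha) sum S_i. *)
rewrite -mulr_sumr.
have := sum_adjacent_le N D0.
have : \sum_(0 <= i < N.+1) D i <= alpha^-1 * \sum_(0 <= i < N.+1) S i.
  rewrite mulr_sumr big_nat [leRHS]big_nat; apply: ler_sum => i /=; rewrite ltnS => iN.
  by rewrite mulrC ler_pdivlMr// mulrC DS.
rewrite -mulrA.
move: (\sum_(_ <= _ < _) _) (\sum_(_ <= _ < _) _) (_ * _) => x y t; lra.
Qed.
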